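(* Let $p\colon\mathcal{E}\to\mathcal{B}$ be an isofibration between connected finite groupoids. If $b$ is an object of $\mathcal{B}$ and $p^{-1}(b)$ is connected, then $$\chi^{(2)}(\mathcal{E})=\chi^{(2)}(p^{-1}(b))\cdot\chi^{(2)}(\mathcal{B}).$$
   Context: A small groupoid is finite if it has finitely many isomorphism classes of objects and all automorphism groups of objects are finite. A functor $p\colon\mathcal{E}\to\mathcal{B}$ is an isofibration if for every object $e$ of $\mathcal{E}$ and every isomorphism $g\colon b\cong p(e)$ in $\mathcal{B}$ there is an isomorphism $f\colon e'\to e$ in $\mathcal{E}$ with $p(f)=g$. $p^{-1}(b)$ is the subgroupoid of objects mapped to $b$ and morphisms mapped to $\mathrm{id}_b$. The $L^2$-Euler characteristic of a small category $\Gamma$: a $\mathbb{C}\Gamma$-module is a functor $\Gamma^{op}\to\mathbb{C}\text{-Mod}$. $\mathbb{C}[x]=\mathbb{C}[\mathrm{aut}(x)]$. $S_xM$ is the right $\mathbb{C}[x]$-module obtained as the quotient of $M(x)$ by the submodule generated by the images of all $M(u)$, $u\colon x\to y$ a non-isomorphism (so $S_xM=M(x)$ for groupoids). $\mathcal{N}(x)$ is the group von Neumann algebra of $\mathrm{aut}(x)$, with (L\''uck) dimension $\dim_{\mathcal{N}(x)}$; for $\mathrm{aut}(x)$ finite, $\mathcal{N}(x)=\mathbb{C}[x]$ and $\dim_{\mathcal{N}(x)}(M)=\dim_{\mathbb{C}}(M)/|\mathrm{aut}(x)|$. With a projective $\mathbb{C}\Gamma$-resolution $P_*$ of the constant module $\underline{\mathbb{C}}$,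 $$\chi^{(2)}(\Gamma)=\sum_{\overline{x}\in\mathrm{iso}(\Gamma)}\sum_p(-1)^p\dim_{\mathcal{N}(x)}H_p\bigl(S_xP_*\otimes_{\mathbb{C}[x]}\mathcal{N}(x)\bigr)$$ whenever the sum is absolutely convergent, where $\mathrm{iso}(\Gamma)$ is the set of isomorphism classes of objects. *)

(* Defs.v *)
From HB Require Import structures.
From Stdlib Require Import Relation_Operators.
From mathcomp Require Import all_boot all_order all_algebra.
From mathcomp Require Import complex.
From mathcomp Require Import all_classical all_reals all_analysis.

Set Implicit Arguments.
Unset Strict Implicit.
Unset Printing Implicit Defensive.

Import Order.TTheory GRing.Theory Num.Theory.

Local Open Scope classical_set_scope.
Local Open Scope ring_scope.

(* [comp g f] is "g after f". *)
Record category := Category {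
  obj :> Type;
  hom : obj -> obj -> Type;
  idc : forall x, hom x x;
  comp : forall x y z, hom y z -> hom x y -> hom x z;
  comp1f : forall x y (f : hom x y), comp (idc y) f = f;
  compf1 : forall x y (f : hom x y), comp f (idc x) = f;
  compA : forall x y z t (h : hom z t) (g : hom y z) (f : hom x y),
    comp h (comp g f) = comp (comp h g) f }.

Arguments idc {c} x.

Section Categories.
Variable K : category.

Definition is_iso (x y : K) (f : hom x y) : Prop :=
  exists g : hom y x, comp g f = idc x /\ comp f g = idc y.

Definition isomorphic (x y : K) : Prop := exists f : hom x y, is_iso f.

Definition iso_class (x : K) : set K := [set y | isomorphic x y].

Definition iso_classes : set (set K) := [set A | exists x : K, A = iso_class x].

Definition iso_repr (A : iso_classes) : K := projT1 (cid (set_valP A)).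

Definition aut (x : K) : set (hom x x) := [set f | is_iso f].

Definition is_groupoid : Prop := forall (x y : K) (f : hom x y), is_iso f.

Definition is_connected : Prop :=
  inhabited K /\
  forall x y : K, clos_refl_sym_trans K (fun x y => inhabited (hom x y)) x y.

Definition finite_auts : Prop := forall x : K, finite_set (@aut x).

Definition is_finite : Prop := finite_set iso_classes /\ finite_auts.

End Categories.

Arguments aut {K} x _.
Arguments iso_classes K _ : clear implicits.

Record functor (K L : category) := Functor {
  fobj :> K -> L;
  fhom : forall x y, hom x y -> hom (fobj x) (fobj y);
  fhom1 : forall x, fhom (idc x) = idc (fobj x);
  fhom_comp : forall x y z (g : hom y z) (f : hom x y),
    fhom (comp g f) = comp (fhom g) (fhom f) }.

Definition hom_cast (K : category) (x x' y y' : K) (hx : x = x') (hy : y = y')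
    (f : hom x y) : hom x' y' :=
  ecast a (hom a y') hx (ecast c (hom x c) hy f).

Definition is_isofibration (E B : category) (p : functor E B) : Prop :=
  forall (e : E) (b : B) (g : hom b (p e)), is_iso g ->
  exists (e' : E) (f : hom e' e) (h : p e' = b),
    is_iso f /\ hom_cast h erefl (fhom p f) = g.

Section Fiber.
Variables (E B : category) (p : functor E B) (b : B).

Definition fiber_obj : Type := {e : E | p e = b}.

Definition fiber_hom (e e' : fiber_obj) : Type :=
  {f : hom (sval e) (sval e') |
    hom_cast (svalP e) (svalP e') (fhom p f) = idc b}.

Lemma hom_cast_id (K : category) (x x' : K) (h : x = x') :
  hom_cast h h (idc x) = idc x'.
Proof. by case: x' / h. Qed.

Lemma hom_cast_comp (K : category) (x x' y y' z z' : K) (hx : x = x')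
    (hy : y = y') (hz : z = z') (g : hom y z) (f : hom x y) :
  hom_cast hx hz (comp g f) = comp (hom_cast hy hz g) (hom_cast hx hy f).
Proof. by case: x' / hx; case: y' / hy; case: z' / hz. Qed.

Lemma fiber_id_subproof (e : fiber_obj) :
  hom_cast (svalP e) (svalP e) (fhom p (idc (sval e))) = idc b.
Proof. by rewrite fhom1 hom_cast_id. Qed.

Lemma fiber_comp_subproof (e1 e2 e3 : fiber_obj)
    (g : fiber_hom e2 e3) (f : fiber_hom e1 e2) :
  hom_cast (svalP e1) (svalP e3) (fhom p (comp (sval g) (sval f))) = idc b.
Proof.
by rewrite fhom_comp (hom_cast_comp _ (svalP e2)) (svalP g) (svalP f) comp1f.
Qed.

Lemma fiber_hom_eq (e e' : fiber_obj) (f g : fiber_hom e e') :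
  sval f = sval g -> f = g.
Proof.
case: f g => [f hf] [g hg] /= fg; case: g / fg hg => hg.
by rewrite (Prop_irrelevance hf hg).
Qed.

Definition fiber_id (e : fiber_obj) : fiber_hom e e :=
  exist _ (idc (sval e)) (fiber_id_subproof e).

Definition fiber_comp (e1 e2 e3 : fiber_obj)
    (g : fiber_hom e2 e3) (f : fiber_hom e1 e2) : fiber_hom e1 e3 :=
  exist _ (comp (sval g) (sval f)) (fiber_comp_subproof g f).

Definition fiber : category.
Proof.
apply: (@Category fiber_obj fiber_hom fiber_id fiber_comp).
- by move=> x y f; apply: fiber_hom_eq; apply: comp1f.
- by move=> x y f; apply: fiber_hom_eq; apply: compf1.
- by move=> x y z t h g f; apply: fiber_hom_eq; apply: compA.
Defined.

End Fiber.

Section Quotients.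
Variable C : fieldType.

Section Generated.
Variables (V : lmodType C) (A : set V).

Definition generated_pred : pred V := fun v =>
  `[< forall S : submodClosed V, (forall a, A a -> a \in S) -> v \in S >].

Lemma generated_submod_closed : submod_closed generated_pred.
Proof.
split; first by apply/asboolP => S _; apply: rpred0.
move=> a u v /asboolP uS /asboolP vS; apply/asboolP => S AS.
by rewrite rpredD ?rpredZ ?uS ?vS.
Qed.

Definition generated : submodClosed V := HB.pack generated_pred
  (GRing.isSubmodClosed.Build C V generated_pred generated_submod_closed).

End Generated.

Section Image.
Variables (V W : lmodType C) (f : {linear V -> W}).

Definition image_pred : pred W := fun w => `[< exists v, f v = w >].

Lemma image_submod_closed : submod_closed image_pred.
Proof.
split; first by apply/asboolP; exists 0; rewrite linear0.
move=> a u v /asboolP[u' <-] /asboolP[v' <-]; apply/asboolP.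
by exists (a *: u' + v'); rewrite linearP.
Qed.

Definition image_submod : submodClosed W := HB.pack image_pred
  (GRing.isSubmodClosed.Build C W image_pred image_submod_closed).

End Image.

Section QuotientModule.
Variables (V : lmodType C) (S : submodClosed V).

Definition submod_zmod : zmodClosed V := HB.pack (GRing.SubmodClosed.sort S)
  (GRing.isZmodClosed.Build V (GRing.SubmodClosed.sort S)
    (GRing.submod_closedB (submodClosedP S))).

Definition quotmod : Type := Quotient.quot submod_zmod.
HB.instance Definition _ := GRing.Zmodule.on quotmod.

Definition quot_proj (v : V) : quotmod := \pi_(Quotient.quot submod_zmod)%qT v.
Definition quot_repr (q : quotmod) : V := repr q.

Lemma quot_reprK q : quot_proj (quot_repr q) = q.
Proof. exact: reprK. Qed.

Lemma quot_projE u v : (quot_proj u = quot_proj v) <-> (u - v \in S).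
Proof.
by split=> [/eqP|uvS]; [|apply/eqP]; rewrite -(Quotient.idealrBE submod_zmod).
Qed.

Lemma quot_projD u v : quot_proj (u + v) = quot_proj u + quot_proj v.
Proof. exact: (raddfD (\pi_(Quotient.quot submod_zmod)%qT)). Qed.

Definition quot_scale (a : C) (q : quotmod) : quotmod :=
  quot_proj (a *: quot_repr q).

Lemma quot_scaleE a v : quot_scale a (quot_proj v) = quot_proj (a *: v).
Proof.
apply/quot_projE; rewrite -scalerBr rpredZ //.
by apply/quot_projE; rewrite quot_reprK.
Qed.

Lemma quot_scaleA a b q : quot_scale a (quot_scale b q) = quot_scale (a * b) q.
Proof. by rewrite -[q]quot_reprK !quot_scaleE scalerA. Qed.

Lemma quot_scale1 : left_id 1 quot_scale.
Proof. by move=> q; rewrite -[q]quot_reprK quot_scaleE scale1r. Qed.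

Lemma quot_scaleDr : right_distributive quot_scale +%R.
Proof.
move=> a p q; rewrite -[p]quot_reprK -[q]quot_reprK -quot_projD !quot_scaleE.
by rewrite scalerDr quot_projD.
Qed.

Lemma quot_scaleDl q : {morph quot_scale^~ q : a b / a + b}.
Proof.
by move=> a b; rewrite -[q]quot_reprK !quot_scaleE scalerDl quot_projD.
Qed.

HB.instance Definition _ := GRing.Zmodule_isLmodule.Build C quotmod
  quot_scaleA quot_scale1 quot_scaleDr quot_scaleDl.

Lemma quot_proj_linear : linear quot_proj.
Proof.
by move=> a u v; rewrite quot_projD -quot_scaleE.
Qed.

HB.instance Definition _ :=
  GRing.isLinear.Build C V quotmod *:%R quot_proj quot_proj_linear.

End QuotientModule.

Section QuotientMap.
Variables (V W : lmodType C) (f : {linear V -> W}).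
Variables (S : submodClosed V) (T : submodClosed W).

(* The map V/S -> W/T induced by [f]; the unused argument ensures that
   it does not depend on the choice of representatives. *)
Definition quot_map of (forall v, v \in S -> f v \in T) :=
  fun q : quotmod S => quot_proj T (f (quot_repr q)).

Lemma quot_mapE (fST : forall v, v \in S -> f v \in T) v :
  quot_map fST (quot_proj S v) = quot_proj T (f v).
Proof.
apply/quot_projE; rewrite -linearB fST //.
by apply/quot_projE; rewrite quot_reprK.
Qed.

Lemma quot_map_linear (fST : forall v, v \in S -> f v \in T) :
  linear (quot_map fST).
Proof.
move=> a p q; rewrite -[p]quot_reprK -[q]quot_reprK -linearP !quot_mapE.
by rewrite !linearP.
Qed.

HB.instance Definition _ (fST : forall v, v \in S -> f v \in T) :=
  GRing.isLinear.Build C (quotmod S) (quotmod T) *:%R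
    (quot_map fST) (quot_map_linear fST).

End QuotientMap.

End Quotients.

Section Dimension.
Variables (R : realType) (C : fieldType).

Definition lin_indep (V : lmodType C) (n : nat) (v : 'I_n -> V) : Prop :=
  forall c : 'I_n -> C, \sum_(i < n) c i *: v i = 0 -> forall i, c i = 0.

(* [A] is meant to be a linear subspace of [V]. *)
Definition vdim (V : lmodType C) (A : set V) : \bar R :=
  ereal_sup [set n%:R%:E | n in
    [set n | exists v : 'I_n -> V, (forall i, A (v i)) /\ lin_indep v]].

(* Homology H_n(V_*, d) of a nonnegatively graded chain complex, as the
   subspace ker / im of V_n / im. *)
Definition cycles (V : nat -> lmodType C)
    (d : forall n, {linear V n.+1 -> V n}) (n : nat) : set (V n) :=
  match n with
  | 0%N => setT
  | m.+1 => [set v | d m v = 0]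
  end.

Definition homology (V : nat -> lmodType C)
    (d : forall n, {linear V n.+1 -> V n}) (n : nat) :
    set (quotmod (image_submod (d n))) :=
  [set quot_proj (image_submod (d n)) z | z in @cycles V d n].

End Dimension.

Section Modules.
Variables (R : realType) (K : category).
Local Notation C := R[i].

Record catmod := Catmod {
  mobj :> K -> lmodType C;
  mres : forall x y, hom x y -> {linear mobj y -> mobj x};
  mres1 : forall x (m : mobj x), mres (idc x) m = m;
  mres_comp : forall x y z (g : hom y z) (f : hom x y) (m : mobj z),
    mres (comp g f) m = mres f (mres g m) }.

Record catmod_hom (M N : catmod) := CatmodHom {
  mmap :> forall x, {linear M x -> N x};
  mmap_nat : forall x y (f : hom x y) (m : M y),
    mmap x (mres M f m) = mres N f (mmap y m) }.

Definition const_catmod : catmod :=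
  @Catmod (fun _ => C^o) (fun x y _ => GRing.Linear.clone _ _ _ _ idfun _)
    (fun _ _ => erefl) (fun _ _ _ _ _ _ => erefl).

Definition surj (M N : catmod) (f : catmod_hom M N) : Prop :=
  forall x (n : N x), exists m, f x m = n.

Definition projective (P : catmod) : Prop :=
  forall (M N : catmod) (q : catmod_hom M N) (f : catmod_hom P N), surj q ->
  exists g : catmod_hom P M, forall x v, q x (g x v) = f x v.

Record resolution (M : catmod) := Resolution {
  rmod :> nat -> catmod;
  rdiff : forall n, catmod_hom (rmod n.+1) (rmod n);
  raug : catmod_hom (rmod 0%N) M;
  raug_surj : surj raug;
  raug_exact : forall x (v : rmod 0%N x),
    raug x v = 0 <-> exists w, rdiff 0%N x w = v;
  rdiff_exact : forall n x (v : rmod n.+1 x),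
    rdiff n x v = 0 <-> exists w, rdiff n.+1 x w = v }.

Definition is_projective_resolution (M : catmod) (P : resolution M) : Prop :=
  forall n, projective (P n).

(* The set of all M(u)(m), with u : x -> y not invertible, is stable under
   aut(x), so the linear subspace it generates is a C[aut(x)]-submodule. *)
Definition noniso_image (M : catmod) (x : K) : set (M x) :=
  [set v | exists y (u : hom x y) (m : M y), ~ is_iso u /\ v = mres M u m].

Definition splitting (x : K) (M : catmod) : lmodType C :=
  quotmod (generated (@noniso_image M x)).

Lemma splitting_map_subproof (x : K) (M N : catmod) (f : catmod_hom M N) v :
  v \in generated (@noniso_image M x) ->
  f x v \in generated (@noniso_image N x).
Proof.
move=> /asboolP vM; apply/asboolP => S NS.
pose T : pred (M x) := fun w => f x w \in S.
have Tclosed : submod_closed T.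
  split; first by rewrite /in_mem /= /T linear0 rpred0.
  by move=> a u w uT wT; rewrite /in_mem /= /T linearP rpredD ?rpredZ.
pose TS : submodClosed (M x) := HB.pack T
  (GRing.isSubmodClosed.Build C (M x) T Tclosed).
apply: (vM TS) => _ [y [u [m [nu ->]]]].
rewrite /in_mem /= /T mmap_nat; apply: NS; by exists y, u, (f y m).
Qed.

Definition splitting_map (x : K) (M N : catmod) (f : catmod_hom M N) :
    {linear splitting x M -> splitting x N} :=
  GRing.Linear.clone _ _ _ _
    (quot_map (@splitting_map_subproof x M N f)) _.

Definition card_aut (x : K) : nat := xget 0%N [set n | (aut x #= `I_n)%card].

(* The von Neumann dimension of the p-th homology of the tensor product of
   S_x P_* with N(x) over C[x], for aut(x) finite: then N(x) = C[x], the
   tensor product is S_x P_* itself, and the dimension is dim_C / |aut(x)|. *)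
Definition l2_betti (M : catmod) (P : resolution M) (x : K) (p : nat) :
    \bar R :=
  (vdim R (@homology C (fun n => splitting x (P n))
             (fun n => splitting_map x (rdiff P n)) p)
   * ((card_aut x)%:R^-1)%:E)%E.

Definition l2_term (P : resolution const_catmod) (i : iso_classes K * nat) :
    \bar R :=
  (((-1) ^+ i.2)%:E * l2_betti P (iso_repr i.1) i.2)%E.

Definition abs_sum (I : choiceType) (f : I -> \bar R) : R :=
  fine (\esum_(i in setT) f^\+ i)%E - fine (\esum_(i in setT) f^\- i)%E.

(* [r] is the L2-Euler characteristic of [K], for [K] all of whose
   automorphism groups are finite. *)
Definition is_l2_euler (r : R) : Prop :=
  finite_auts K /\
  exists P : resolution const_catmod,
    [/\ is_projective_resolution P,
        summable setT (l2_term P) &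
        r = abs_sum (l2_term P)].

(* By comparison of projective resolutions, at most one [r] satisfies
   [is_l2_euler r]; the value is 0 when there is none. *)
Definition l2_euler : R := xget 0 [set r | is_l2_euler r].

End Modules.

(* Main.v *)
From HB Require Import structures.
Require Import Defs.
From mathcomp Require Import all_boot all_order all_algebra.
From mathcomp Require Import complex.
From mathcomp Require Import all_classical all_reals all_analysis.

Import Order.TTheory GRing.Theory Num.Theory.

(** A connected groupoid K with finite automorphism groups has L2-Euler
    characteristic 1 / |aut(x)|, for any object x ([l2_euler_connected]), so the
    theorem amounts to |aut(e)| = |aut_fiber(e)| * |aut(b)| for e over b.

    The value can be read off from any resolution of the constant module.  In a groupoid there are no non-invertible
    morphisms, so the splitting functor S_x is evaluation at x, and a resolution
    of the constant module is exact after evaluation.  The homology is therefore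
    C in degree 0 and zero in positive degrees ([vdim_homology0],
    [vdim_homologyS]), and a connected groupoid has just one isomorphism class,
    so the defining sum has a single nonzero term.

    A projective resolution has to exist, too.  As C has characteristic zero and
    the automorphism groups are finite, a preimage of 1 under a surjection of
    modules can be averaged over aut(x) to an invariant one, which then extends
    to all objects by connectedness.  Hence the constant module is itself
    projective ([const_projective]), and it resolves itself.

    For the count ([card_aut_fiber]), p maps aut(e) to aut(b) with kernel the
    automorphism group of e in the fiber.  This map is onto ([aut_lift]): the
    isofibration lifts g in aut(b) to an isomorphism e' -> e whose source lies
    in the fiber, and connectedness of the fiber gives a morphism e -> e' over
    the identity of b to precompose with. *)

Local Open Scope classical_set_scope.
Local Open Scope ring_scope.

Local Notation hom := Defs.hom.
Local Notation compA := Defs.compA.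
Local Notation "g \c f" := (Defs.comp g f) (at level 50).

Lemma inj_surj_bijective (T U : Type) (f : T -> U) :
  injective f -> (forall y, exists x, f x = y) -> bijective f.
Proof.
move=> finj fsurj; pose g y := projT1 (cid (fsurj y)).
have gK : cancel g f by move=> y; exact: projT2 (cid (fsurj y)).
by exists g => // x; apply: finj; rewrite gK.
Qed.

(** * Automorphism groups in groupoids *)

Section Groupoids.
Context {K : category} (Kgpd : is_groupoid K).

Lemma aut_setT (x : K) : aut x = [set: hom x x].
Proof. by apply/seteqP; split=> // f _; apply: Kgpd. Qed.

Lemma groupoid_compI (x y z : K) (g : hom y z) (f1 f2 : hom x y) :
  g \c f1 = g \c f2 -> f1 = f2.
Proof.
have [k [kg _]] := Kgpd _ _ g => /(congr1 (fun f => k \c f)).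
by rewrite !compA kg !comp1f.
Qed.

Lemma groupoid_compIr (x y z : K) (g1 g2 : hom y z) (f : hom x y) :
  g1 \c f = g2 \c f -> g1 = g2.
Proof.
have [k [_ fk]] := Kgpd _ _ f => /(congr1 (fun g => g \c k)).
by rewrite -!compA fk !compf1.
Qed.

Lemma groupoid_comp_surj (x y z : K) (g : hom y z) (f : hom x z) :
  exists k, g \c k = f.
Proof.
by have [h [_ gh]] := Kgpd _ _ g; exists (h \c f); rewrite compA gh comp1f.
Qed.

Lemma groupoid_comp_surjr (x y z : K) (f : hom x y) (g : hom x z) :
  exists k, k \c f = g.
Proof.
by have [h [hf _]] := Kgpd _ _ f; exists (g \c h); rewrite -compA hf compf1.
Qed.

Lemma connected_hom : is_connected K -> forall x y : K, inhabited (hom x y).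
Proof.
move=> [_ Kconn] x y.
elim: (Kconn x y) => {x y} [//|x|x y _ [f]|x y z _ [f] _ [g]].
- exact: inhabits (idc x).
- by have [g _] := Kgpd _ _ f; exact: inhabits g.
- exact: inhabits (g \c f).
Qed.

Lemma card_aut_bijective (x : K) (T : finType) (h : T -> hom x x) :
  bijective h -> card_aut x = #|T|.
Proof.
case=> k hK kK; have autT : (aut x #= `I_#|T|)%card.
  apply/card_set_bijP; exists (fun f => nat_of_ord (enum_rank (k f))); split.
  - by move=> f _ /=; apply: ltn_ord.
  - by move=> f g _ _ /val_inj/enum_rank_inj/(can_inj kK).
  - move=> i /= ltiT; exists (h (enum_val (Ordinal ltiT))).
      exact: Kgpd.
    by rewrite hK enum_valK.
apply/card_eq_II/(card_eq_trans (card_esym _) autT).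
by apply: (@xgetPex nat 0%N [set n | (aut x #= `I_n)%card]); exists #|T|.
Qed.

Context (Kfin : finite_auts K).

(** Indexing aut(x) by ordinals makes sums over the group available as
    ordinary finite sums, and products of groups as products of finite types. *)
Lemma aut_enum (x : K) : exists h : 'I_(card_aut x) -> hom x x, bijective h.
Proof.
have : (aut x #= `I_(card_aut x))%card.
  apply: (@xgetPex nat 0%N [set n | (aut x #= `I_n)%card]).
  exact/finite_setP/Kfin.
move=> /card_set_bijP[f [fun_f inj_f surj_f]].
have h_ex (i : 'I_(card_aut x)) : exists u, f u = i.
  by have [u _ <-] := surj_f i (ltn_ord i); exists u.
pose h i := projT1 (cid (h_ex i)).
have fh i : f (h i) = i by exact: projT2 (cid (h_ex i)).
exists h; apply: inj_surj_bijective => [i j /(congr1 f)|u].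
  by rewrite !fh => /val_inj.
exists (Ordinal (fun_f u (Kgpd _ _ u))).
by apply: inj_f; rewrite ?fh // inE; apply: Kgpd.
Qed.

Lemma card_aut_gt0 (x : K) : (0 < card_aut x)%N.
Proof.
have [h [k _ _]] := aut_enum x.
exact: leq_ltn_trans (ltn_ord (k (idc x))).
Qed.

(** Conjugation by a morphism from x to y identifies aut(x) with aut(y). *)
Lemma card_aut_connected : is_connected K ->
  forall x y : K, card_aut x = card_aut y.
Proof.
move=> /connected_hom Kconn x y; have [u] := Kconn x y.
have [v [vu uv]] := Kgpd _ _ u; have [h [k hK kK]] := aut_enum y.
rewrite (@card_aut_bijective x _ (fun i => v \c (h i \c u))) ?card_ord //.
exists (fun f => k (u \c (f \c v))) => [i|f].
  by rewrite -!compA uv compf1 compA uv comp1f hK.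
by rewrite kK -!compA vu compf1 compA vu comp1f.
Qed.

Lemma connected_iso_classes : is_connected K ->
  forall A B : iso_classes K, A = B.
Proof.
move=> /connected_hom Kconn [A Aiso] [B Biso]; apply/val_inj => /=.
have classT (x : K) : iso_class x = setT.
  apply/seteqP; split=> // y _; have [f] := Kconn x y.
  by exists f; apply: Kgpd.
move: Aiso Biso; rewrite !inE => -[x ->] [y ->].
by rewrite !classT.
Qed.

End Groupoids.

(** * Dimensions of homology *)

Section Dimensions.
Context {R : realType} {C : fieldType} {V : lmodType C}.

Lemma vdim0 (A : set V) : (forall v, A v -> v = 0) -> vdim R A = 0%E.
Proof.
move=> A0; rewrite /vdim; apply/eqP; rewrite eq_le; apply/andP; split.
  apply: ge_ereal_sup => _ [n [v [Av vI]] <-]; rewrite lee_fin.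
  case: n v Av vI => [//|n] v Av vI; have := vI (fun=> 1).
  rewrite big1 => [/(_ erefl ord0)/eqP|i _]; first by rewrite oner_eq0.
  by rewrite (A0 _ (Av i)) scaler0.
apply: ereal_sup_ubound; exists 0%N => //=; exists (fun=> 0).
by split=> [[]|c _ []].
Qed.

Lemma vdim1 (A : set V) (a : V) : A a -> a != 0 ->
  (forall v, A v -> exists c, v = c *: a) -> vdim R A = 1%E.
Proof.
move=> Aa a0 Aspan; rewrite /vdim; apply/eqP; rewrite eq_le; apply/andP; split.
  apply: ge_ereal_sup => _ [[|[|n]] [v [Av vI]] <-]; rewrite lee_fin ?ler01 //.
  have [c vc] := Aspan _ (Av ord0).
  have [d vd] := Aspan _ (Av (lift ord0 ord0)).
  (* Two multiples c *: a and d *: a satisfy the relation with coefficients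
     d and - c; it forces d = 0, and then the second vector is zero. *)
  have relE (r s : C) : r *: v ord0 + s *: v (lift ord0 ord0) = 0 ->
      r = 0 /\ s = 0.
    move=> rs0; have := vI (fun i => if i == ord0 then r
      else if i == lift ord0 ord0 then s else 0).
    rewrite !big_ord_recl /= big1 => [|i _]; last by rewrite scale0r.
    rewrite addr0 => /(_ rs0) rs.
    by split; [apply: (rs ord0)|apply: (rs (lift ord0 ord0))].
  have [d0 _] : d = 0 /\ - c = 0.
    by apply: relE; rewrite vc vd !scalerA mulNr mulrC scaleNr subrr.
  have [_ /eqP] : (0 : C) = 0 /\ (1 : C) = 0.
    by apply: relE; rewrite vd d0 !scale0r scaler0 addr0.
  by rewrite oner_eq0.
apply: ereal_sup_ubound; exists 1%N => //=; exists (fun=> a).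
split=> // c; rewrite big_ord1 => /eqP; rewrite scaler_eq0 (negPf a0) orbF.
by move=> /eqP c0 i; rewrite ord1.
Qed.

End Dimensions.

Section Resolutions.
Context {R : realType} {K : category} (Kgpd : is_groupoid K).
Local Notation C := R[i].

(** The submodule divided out by the splitting functor is generated by images
    of non-invertible morphisms, of which a groupoid has none; so it lies in
    the zero submodule. *)
Lemma splitting_proj_inj (x : K) (M : catmod R K) :
  injective (fun m : M x => quot_proj (generated (@noniso_image R K M x)) m).
Proof.
move=> m n /quot_projE /asboolP mnS; apply/eqP; rewrite -subr_eq0; apply/eqP.
pose Z : pred (M x) := fun v => v == 0.
have Zclosed : submod_closed Z.
  split=> [|a u v]; rewrite !unfold_in /Z ?eqxx // => /eqP-> /eqP->.
  by rewrite scaler0 addr0.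
pose ZS : submodClosed (M x) := HB.pack Z
  (GRing.isSubmodClosed.Build C (M x) Z Zclosed).
have /eqP-> // : (m - n) \in ZS.
by apply: mnS => v [y [u [k [nu _]]]]; case: nu; apply: Kgpd.
Qed.

Context (P : resolution (const_catmod R K)).

Local Notation Hmlgy x n := (@homology C (fun k => splitting x (P k))
  (fun k => splitting_map x (rdiff P k)) n).

(** The augmentation identifies the homology in degree 0 with C; a preimage of
    1 is a generator. *)
Lemma vdim_homology0 (x : K) : vdim R (Hmlgy x 0%N) = 1%E.
Proof.
have [m0 m01] := @raug_surj _ _ _ P x (1 : C).
pose pr (v : P 0%N x) :=
  quot_proj (image_submod (splitting_map x (rdiff P 0)))
    (quot_proj (generated (@noniso_image R K (P 0%N) x)) v).
have pr_eq0 v : pr v = 0 <-> raug P x v = 0.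
  refine (iff_trans _ (iff_sym (raug_exact v))).
  rewrite /pr -(linear0 (quot_proj _)); split.
    move=> /quot_projE; rewrite subr0 => /asboolP[w].
    rewrite -[w]quot_reprK /splitting_map /= quot_mapE.
    by move=> /splitting_proj_inj <-; eexists.
  move=> [w <-]; apply/quot_projE; rewrite subr0; apply/asboolP.
  by exists (quot_proj _ w); rewrite /splitting_map /= quot_mapE.
apply: (@vdim1 _ _ _ _ (pr m0)).
- by eexists.
- by apply/eqP => /pr_eq0; rewrite m01 => /eqP; rewrite oner_eq0.
- move=> _ [z _ <-]; rewrite -[z]quot_reprK; set v := quot_repr z.
  exists (raug P x v); apply/eqP; rewrite -subr_eq0; apply/eqP.
  rewrite -!linearZ -!linearB; apply/pr_eq0.
  by rewrite linearB linearZ m01 /= [_ *: _]mulr1 subrr.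
Qed.

Lemma vdim_homologyS (x : K) (n : nat) : vdim R (Hmlgy x n.+1) = 0%E.
Proof.
apply: vdim0 => _ [z dz0 <-]; move: dz0; rewrite /cycles /= -[z]quot_reprK.
set v := quot_repr z; rewrite quot_mapE -(linear0 (quot_proj _)).
move=> /splitting_proj_inj /rdiff_exact[w wv].
rewrite -(linear0 (quot_proj _)); apply/quot_projE; rewrite subr0.
apply/asboolP; exists (quot_proj _ w).
by rewrite /splitting_map /= quot_mapE wv.
Qed.

Context (Kconn : is_connected K) (Kfin : finite_auts K).

Lemma l2_termE (x : K) (i : iso_classes K * nat) :
  l2_term P i = if i.2 == 0%N then ((card_aut x)%:R^-1)%:E else 0%E.
Proof.
rewrite /l2_term /l2_betti (card_aut_connected Kgpd Kfin Kconn _ x).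
case: i => A [|n] /=; first by rewrite vdim_homology0 expr0 !mul1e.
by rewrite vdim_homologyS mul0e mule0.
Qed.

(** There is a single isomorphism class, so the only index in degree 0 is the
    pair of that class and 0. *)
Lemma esum_degree0 (r : R) : 0 <= r ->
  (\esum_(i in [set: iso_classes K * nat])
     (if i.2 == 0%N then r%:E else 0) = r%:E)%E.
Proof.
move=> r0; have [x] := Kconn.1.
have xK : iso_class x \in (iso_classes K : set (set K)).
  by rewrite inE; exists x.
pose A : iso_classes K := SigSub xK.
rewrite -[RHS](@esum_set1 R _ (A, 0%N) (fun=> r%:E)) ?lee_fin //.
rewrite [RHS]esum_mkcond; apply: eq_esum => -[B n] _ /=.
have -> : B = A by apply: connected_iso_classes.
congr (if _ then _ else _); apply/eqP/idP => [->|]; rewrite inE //=.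
by case.
Qed.

Lemma summable_l2_term : summable setT (l2_term P).
Proof.
have [x] := Kconn.1; rewrite /summable.
rewrite (eq_esum (b := fun i =>
  if i.2 == 0%N then ((card_aut x)%:R^-1)%:E else 0%E)).
  by rewrite esum_degree0 ?ltry // invr_ge0.
move=> i _; rewrite (l2_termE x); case: ifP; rewrite ?abse0 //.
by rewrite abse_EFin ger0_norm ?invr_ge0.
Qed.

Lemma abs_sum_l2_term (x : K) : abs_sum (l2_term P) = (card_aut x)%:R^-1.
Proof.
have r0 : 0 <= (card_aut x)%:R^-1 :> R by rewrite invr_ge0.
rewrite /abs_sum.
rewrite (eq_esum (b := fun i =>
  if i.2 == 0%N then ((card_aut x)%:R^-1)%:E else 0%E)).
  rewrite [X in _ - fine X]esum1 ?esum_degree0 ?subr0 //.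
  move=> i _; rewrite funenegE (l2_termE x); case: ifP;
    rewrite ?oppe0 ?maxxx //.
  by move=> _; apply/max_idPr; rewrite oppe_le0 lee_fin.
move=> i _; rewrite funeposE (l2_termE x); case: ifP; rewrite ?maxxx //.
by move=> _; apply/max_idPl; rewrite lee_fin.
Qed.

End Resolutions.

(** * The constant module is projective *)

Section ConstantProjective.
Context (R : realType) {K : category}.
Local Notation C := R[i].

(** A lift of 1 at one object x0, averaged over aut(x0), is invariant.  Its
    restriction along a morphism x -> x0 is then the same for all such
    morphisms, which makes a choice of them for each x natural in x. *)
Lemma const_projective : is_groupoid K -> is_connected K -> finite_auts K ->
  projective (const_catmod R K).
Proof.
move=> Kgpd Kconn Kfin M N q f qsurj; have [x0] := Kconn.1.
have [m0 qm0] := qsurj x0 (f x0 1).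
have [h hbij] := aut_enum Kgpd Kfin x0; have [k hK kK] := hbij.
set n := card_aut x0 in h hbij k hK kK.
have n0 : n%:R != 0 :> C.
  by rewrite pnatr_eq0 -lt0n card_aut_gt0.
pose m1 := n%:R^-1 *: \sum_i mres M (h i) m0.
have qm1 : q x0 m1 = f x0 1.
  rewrite /m1 linearZ linear_sum /=.
  under eq_bigr => i _ do rewrite mmap_nat qm0 -mmap_nat /=.
  rewrite sumr_const card_ord -[f x0 _ *+ _]scaler_nat scalerA mulVf //.
  exact: scale1r.
have m1_inv g : mres M g m1 = m1.
  rewrite /m1 linearZ linear_sum /=; congr (_ *: _).
  under eq_bigr => i _ do rewrite -mres_comp.
  rewrite [RHS](reindex_inj (h := fun i => k (h i \c g))) /=.
    by apply: eq_bigr => i _; rewrite kK.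
  move=> i j /(can_inj kK)/(groupoid_compIr Kgpd).
  exact: can_inj hK _ _.
(* Only the two properties of m1 matter below; with its body visible,
   linearity would expand it. *)
clearbody m1.
have hom_x0 x : hom x x0.
  suff /cid[] : exists u : hom x x0, True by [].
  by have [u] := connected_hom Kgpd Kconn x x0; exists u.
pose s x (c : C^o) : M x := c *: mres M (hom_x0 x) m1.
have s_linear x : linear (s x).
  by move=> a c d; rewrite /s scalerDl -scalerA.
pose sL x : {linear C^o -> M x} := HB.pack (s x)
  (GRing.isLinear.Build C C^o (M x) *:%R (s x) (s_linear x)).
have s_nat x y (v : hom x y) (c : const_catmod R K y) :
    sL x (mres (const_catmod R K) v c) = mres M v (sL y c).
  rewrite /= /s linearZ /= -mres_comp.
  have [g <-] := groupoid_comp_surjr Kgpd _ _ _ (hom_x0 x) (hom_x0 y \c v).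
  by rewrite mres_comp m1_inv.
exists (CatmodHom s_nat) => x c.
rewrite /= /s linearZ /= mmap_nat qm1 -mmap_nat -linearZ /=.
by rewrite [_ *: _]mulr1.
Qed.

Definition zero_catmod : catmod R K :=
  @Catmod R K (fun _ => 'rV[C]_0)
    (fun x y _ => GRing.Linear.clone _ _ _ _ idfun _)
    (fun _ _ => erefl) (fun _ _ _ _ _ _ => erefl).

Lemma zero_catmodE (x : K) (m : zero_catmod x) : m = 0.
Proof. exact: thinmx0. Qed.

Lemma zero_hom_nat (M N : catmod R K) (x y : K) (f : hom x y) (m : M y) :
  (\0 : {linear M x -> N x}) (mres M f m)
  = mres N f ((\0 : {linear M y -> N y}) m).
Proof. by rewrite linear0. Qed.

Definition zero_hom (M N : catmod R K) : catmod_hom M N :=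
  @CatmodHom R K M N (fun x => \0) (@zero_hom_nat M N).

Definition id_hom (M : catmod R K) : catmod_hom M M :=
  @CatmodHom R K M M (fun x => idfun) (fun _ _ _ _ => erefl).

Definition degree0_mod (M : catmod R K) (n : nat) : catmod R K :=
  if n is 0%N then M else zero_catmod.

(** Every module resolves itself; the resolution is projective when the module
    is. *)
Definition degree0_resolution (M : catmod R K) : resolution M.
Proof.
apply: (@Resolution R K M (degree0_mod M)
  (fun n => zero_hom (degree0_mod M n.+1) (degree0_mod M n)) (id_hom M)).
- by move=> x m; exists m.
- by move=> x v; split=> [/= ->|[w <-]//]; exists 0.
- by move=> n x v; split=> // _; exists 0; rewrite (zero_catmodE _ v).
Defined.

Lemma zero_projective : projective zero_catmod.
Proof.
move=> M N q f _; exists (zero_hom zero_catmod M) => x v.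
by rewrite (zero_catmodE _ v) !linear0.
Qed.

(** The constant module shows that some value satisfies the defining property
    of the L2-Euler characteristic; that value is the same for every
    resolution. *)
Lemma l2_euler_connected (x : K) :
  is_groupoid K -> is_connected K -> finite_auts K ->
  l2_euler R K = (card_aut x)%:R^-1.
Proof.
move=> Kgpd Kconn Kfin.
have : is_l2_euler K (l2_euler R K).
  apply: (@xgetPex R 0 [set r | is_l2_euler K r]).
  exists (abs_sum (l2_term (degree0_resolution (const_catmod R K)))).
  split=> //; exists (degree0_resolution (const_catmod R K)); split=> //.
  - by case=> [|n]; [exact: const_projective|exact: zero_projective].
  - exact: summable_l2_term.
by case=> _ [P [_ _ ->]]; exact: abs_sum_l2_term.
Qed.

End ConstantProjective.

(** * The fiber of an isofibration *)

Lemma hom_cast_transpose (K : category) (x x' y y' : K)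
    (hx : x = x') (hy : y = y') (f : hom x y) (g : hom x' y') :
  hom_cast hx erefl f = hom_cast erefl (esym hy) g -> hom_cast hx hy f = g.
Proof. by case: y' / hy g; case: x' / hx. Qed.

Section FiberSequence.
Context {E B : category} (p : functor E B) (b : B).
Context (Egpd : is_groupoid E).

(** The inverse in E of a morphism over the identity is again over the
    identity. *)
Lemma fiber_groupoid : is_groupoid (fiber p b).
Proof.
move=> x y [f hf]; have [g [gf fg]] := Egpd _ _ f.
have hg : hom_cast (svalP y) (svalP x) (fhom p g) = idc b.
  rewrite -[LHS]compf1 -{1}hf -hom_cast_comp -fhom_comp gf fhom1.
  exact: hom_cast_id.
by exists (exist _ g hg); split; apply: fiber_hom_eq.
Qed.

Lemma fiber_finite_auts : finite_auts E -> finite_auts (fiber p b).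
Proof.
move=> Efin x; rewrite (aut_setT fiber_groupoid).
have := Efin (sval x); rewrite (aut_setT Egpd).
rewrite -(preimage_setT (fun f : hom x x => sval f)).
by apply: finite_preimage => f g _ _; apply: fiber_hom_eq.
Qed.

Context (p_fib : is_isofibration p) (Fconn : is_connected (fiber p b)).
Context (Bgpd : is_groupoid B).

Local Notation proj x f := (hom_cast (svalP x) (svalP x) (fhom p f)).

(** The isofibration lifts g to a morphism f : y -> x with y in the fiber, and a
    morphism k : x -> y of the connected fiber turns f into an endomorphism of
    x without changing its image. *)
Lemma aut_lift (x : fiber p b) (g : hom b b) :
  exists f : hom (sval x) (sval x), proj x f = g.
Proof.
have [y [f [hy [_ pf]]]] :=
  p_fib (sval x) b (hom_cast erefl (esym (svalP x)) g) (Bgpd _ _ _).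
pose y' : fiber p b := exist _ y hy.
have [[k pk]] := connected_hom fiber_groupoid Fconn x y'.
exists (f \c k); rewrite fhom_comp (hom_cast_comp _ (svalP y')) pk compf1.
by apply: hom_cast_transpose; rewrite (Prop_irrelevance (svalP y') hy).
Qed.

(** With s a set-theoretic section of aut(x) -> aut(b), the pairs (k, u) of
    an automorphism k in the fiber and u in aut(b) correspond to the
    automorphisms s(u) k of x. *)
Lemma card_aut_fiber (x : fiber p b) : finite_auts E -> finite_auts B ->
  card_aut (sval x) = (card_aut x * card_aut b)%N.
Proof.
move=> Efin Bfin.
have [h [h' hK h'K]] := aut_enum fiber_groupoid (fiber_finite_auts Efin) x.
have [g [g' gK g'K]] := aut_enum Bgpd Bfin b.
pose s u := projT1 (cid (aut_lift x u)).
have ps u : proj x (s u) = u by exact: projT2 (cid (aut_lift x u)).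
have p_mul u (k : hom x x) : proj x (s u \c sval k) = u.
  by rewrite fhom_comp (hom_cast_comp _ (svalP x)) ps (svalP k) compf1.
rewrite -[card_aut x]card_ord -[card_aut b]card_ord -card_prod.
apply: (card_aut_bijective Egpd _ _
  (fun ij => s (g ij.2) \c sval (h ij.1))).
apply: inj_surj_bijective => [[i j] [i' j'] /= eq_ij|f].
  have eq_j : j = j'.
    by apply: (can_inj gK); rewrite -[LHS](p_mul _ (h i)) eq_ij p_mul.
  move: eq_ij; rewrite eq_j => /(groupoid_compI Egpd)/fiber_hom_eq.
  by move=> /(can_inj hK) ->.
have [k kf] := groupoid_comp_surj Egpd _ _ _ (s (proj x f)) f.
(* The section lifts the image of f, so the remaining factor k lies over the
   identity. *)
have pk : proj x k = idc b.
  apply: (groupoid_compI Bgpd _ _ _ (proj x f)).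
  by rewrite -{1}[proj x f]ps -hom_cast_comp -fhom_comp kf compf1.
exists (h' (exist _ k pk), g' (proj x f)) => /=.
by rewrite g'K h'K.
Qed.

End FiberSequence.

Theorem theorem5p37 (R : realType) (E B : category) (p : functor E B) (b : B) :
  is_groupoid E -> is_connected E -> is_finite E ->
  is_groupoid B -> is_connected B -> is_finite B ->
  is_isofibration p ->
  is_connected (fiber p b) ->
  l2_euler R E = l2_euler R (fiber p b) * l2_euler R B.
Proof.
move=> Egpd Econn [_ Efin] Bgpd Bconn [_ Bfin] p_fib Fconn.
have [x] := Fconn.1.
rewrite (l2_euler_connected _ (sval x)) // (l2_euler_connected _ b) //.
rewrite (l2_euler_connected _ x) //.
- by rewrite (@card_aut_fiber _ _ _ _ _ p_fib) // natrM invfM.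
- exact: fiber_groupoid.
- exact: fiber_finite_auts.
Qed.
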